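(* If $M$ is a constant slope surface in $\mathbb E^4$ (in the sense fixed in the context, with constant angle $\theta\in(0,\pi/2)$), then the tangential component $x^T$ of its position vector $x$ is a principal direction of all shape operators of $M$.
   Context: $\mathbb E^4$ is Euclidean 4-space with its canonical metric $\langle\ ,\ \rangle$. A normal vector field $\xi$ on a submanifold is parallel if $D\xi=0$, where $D$ is the normal connection; $S_\xi$ denotes the shape operator in the direction $\xi$. A vector is a principal direction of $S_\xi$ if it is an eigenvector of $S_\xi$. Constant slope surface (CSS): a surface $M$ in $\mathbb E^4$ with position vector $x$ for which there exists a parallel normal vector field making a constant angle with $x$. Concretely, with $\mu>0$, $\mu^2=\langle x,x\rangle$, there are a unit parallel normal vector field $e_3$, a unit tangent vector field $e_1$ and a constant $\theta$ such that $$x=\mu\cos\theta\, e_1+\mu\sin\theta\, e_3 .$$ The trivial cases $\theta=0$ and $\theta=\pi/2$ are excluded; that is, $\theta\in(0,\pi/2)$. *)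

(* Defs.v *)
From HB Require Import structures.
From mathcomp Require Export all_boot all_order all_algebra.
From mathcomp Require Export all_classical all_reals all_analysis.
Export Order.TTheory GRing.Theory Num.Theory.
Export numFieldNormedType.Exports.

Set Implicit Arguments.
Unset Strict Implicit.
Unset Printing Implicit Defensive.

Global Open Scope classical_set_scope.
Global Open Scope ring_scope.

(* Vectors are row vectors, so the Jacobian 'J f u of f : R^2 -> R^4 is the
   2 x 4 matrix whose rows are the partial derivatives of f, a differential is
   v |-> v *m 'J f u, and linear operators of R^4 act on the right.  The norm
   of 'rV[R]_4 in the library is the sup norm (it is only used through its
   topology); the Euclidean metric is [dot]. *)
Definition dot (R : realType) (n : nat) (v w : 'rV[R]_n) : R :=
  (v *m w^T) 0 0.

Fixpoint Ck (R : realType) (V W : normedModType R) (k : nat)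
    (U : set V) (f : V -> W) : Prop :=
  match k with
  | 0%N => forall u, U u -> {for u, continuous f}
  | k'.+1 => (forall u, U u -> differentiable f u) /\
             (forall v : V, Ck k' U (fun u => 'D_v f u))
  end.

Definition smooth_on (R : realType) (V W : normedModType R)
    (U : set V) (f : V -> W) : Prop := forall k, Ck k U f.

(* In this section f plays the role of a parametrization of a piece of surface
   in E^4, and n that of a vector field along it, as a function of the
   parameters. *)
Section ParametrizedSurface.
Variable R : realType.
Implicit Types (f n : 'rV[R]_2 -> 'rV[R]_4) (u : 'rV[R]_2) (w : 'rV[R]_4).

Definition tangent f u w : Prop := (w <= 'J f u)%MS.

Definition normal f u w : Prop := forall t, tangent f u t -> dot t w = 0.

(* The orthogonal projection of R^4 onto the tangent plane:
   kermx ('J f u)^T is its orthogonal complement. *)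
Definition tan_proj f u : 'M[R]_4 :=
  proj_mx <<'J f u>>%MS (kermx ('J f u)^T).

Definition tan_part f u w : 'rV[R]_4 := w *m tan_proj f u.

(* The derivative w |-> ~D_w n of the field n along the surface, for the flat
   connection ~D of R^4.  It is meaningful for w tangent: then
   w *m pinvmx ('J f u) is the v such that w = v *m 'J f u. *)
Definition flat_deriv f n u : 'M[R]_4 := pinvmx ('J f u) *m 'J n u.

(* Weingarten formula: ~D_w n = - S_n w + D_w n for n normal, w tangent. *)
Definition shape_op f n u : 'M[R]_4 := - (flat_deriv f n u *m tan_proj f u).

Definition normal_conn f n u : 'M[R]_4 :=
  flat_deriv f n u *m (1%:M - tan_proj f u).

Definition parallel_at f n u : Prop :=
  forall w, tangent f u w -> w *m normal_conn f n u = 0.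

Definition principal_direction f n u w : Prop :=
  [/\ w != 0, tangent f u w &
      exists k : R, (w <= eigenspace (shape_op f n u) k)%MS].

End ParametrizedSurface.

Section ImmersedSurface.
Variables (R : realType) (M : topologicalType) (x : M -> 'rV[R]_4).

(* r restricted to the open set U is a homeomorphism onto an open subset of M
   and x \o r is a smooth immersion on U. *)
Definition local_param (U : set 'rV[R]_2) (r : 'rV[R]_2 -> M) : Prop :=
  [/\ open U,
      (forall u, U u -> {for u, continuous r}) /\
        (forall u v, U u -> U v -> r u = r v -> u = v),
      forall W, W `<=` U -> open W -> open (r @` W),
      smooth_on U (x \o r) &
      forall u, U u -> row_free ('J (x \o r) u)].

(* x is the position vector of a (not necessarily injectively) immersed surface
   M.  The smooth structure of M is the one whose charts are the inverses of
   the local parametrizations; these are automatically smoothly compatible,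
   since the maps x \o r are immersions. *)
Definition immersed_surface : Prop :=
  [/\ hausdorff_space M, @second_countable M &
      forall p : M, exists U r, local_param U r /\ (r @` U) p].

(* Fields along the open subset V of M, with values in R^4. *)
Definition smooth_field (V : set M) (e : M -> 'rV[R]_4) : Prop :=
  forall U r, local_param U r -> smooth_on (U `&` r @^-1` V) (e \o r).

Definition tangent_field (V : set M) (e : M -> 'rV[R]_4) : Prop :=
  smooth_field V e /\
  forall U r, local_param U r ->
    forall u, U u -> V (r u) -> tangent (x \o r) u (e (r u)).

Definition normal_field (V : set M) (e : M -> 'rV[R]_4) : Prop :=
  smooth_field V e /\
  forall U r, local_param U r ->
    forall u, U u -> V (r u) -> normal (x \o r) u (e (r u)).

Definition parallel_field (V : set M) (e : M -> 'rV[R]_4) : Prop :=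
  forall U r, local_param U r ->
    forall u, U u -> V (r u) -> parallel_at (x \o r) (e \o r) u.

Definition unit_field (e : M -> 'rV[R]_4) : Prop :=
  forall p, dot (e p) (e p) = 1.

Definition constant_slope_surface (theta : R) : Prop :=
  immersed_surface /\
  exists (mu : M -> R) (e1 e3 : M -> 'rV[R]_4),
    [/\ forall p, 0 < mu p /\ mu p ^+ 2 = dot (x p) (x p),
        tangent_field setT e1 /\ unit_field e1,
        [/\ normal_field setT e3, unit_field e3 & parallel_field setT e3] &
        forall p, x p = (mu p * cos theta) *: e1 p
                        + (mu p * sin theta) *: e3 p].

End ImmersedSurface.

(* Main.v *)
Require Import Defs.
From mathcomp Require Import ring.

(** Write the position vector as x = T + s e3, where T = mu cos(theta) e1 is its
tangential part and s = mu sin(theta) = <x, e3>, and let n be a normal field.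
The derivative of x along a tangent vector v is v itself, so that identities
between products of x, e3 and n are easily differentiated along v.

From s^2 = sin(theta)^2 <x, x> one gets ds(v) = sin(theta) cos(theta) <e1, v>.
From <x, n> = s <e3, n> one gets
  <T, dn(v)> + s <e3, dn(v)> = s <e3, dn(v)> + ds(v) <e3, n>,
because v and de3(v) are tangent, the latter as e3 is parallel.  Hence
  <T, dn(v)> = sin(theta) cos(theta) <n, e3> <e1, v>
([constant_slope_derive]).

The second fundamental form being symmetric ([derive_normal_sym]), the left-hand
side is also <v, dn(T)>.  As v is arbitrary, the tangential part of dn(T), which
is minus the image of T under the shape operator, is a multiple of e1, that is
of T.

The symmetry of the second fundamental form is that of the second derivative of
the parametrization.  It is Clairaut's theorem ([clairaut]), proved below by
evaluating a second difference in two ways with the mean value theorem. *)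

Set Implicit Arguments.
Unset Strict Implicit.
Unset Printing Implicit Defensive.

(** * Symmetry of second directional derivatives *)

Lemma near_eq_continuous (T U : topologicalType) (f g : T -> U) (a : T) :
  (\forall y \near a, f y = g y) ->
  {for a, continuous f} -> {for a, continuous g}.
Proof.
move=> fg; rewrite /prop_for /continuous_at (nbhs_singleton fg) => fa.
exact: cvg_trans (near_eq_cvg fg) fa.
Qed.

Section Clairaut.
Variables (R : realType) (V : normedModType R).
Implicit Types (g : V -> R) (p v w a : V) (h s t : R).

Lemma is_derive_line g p v s : derivable g (s *: v + p) v ->
  is_derive s 1 (fun t => g (t *: v + p)) ('D_v g (s *: v + p)).
Proof.
have E : (fun h => h^-1 *: (g ((h *: 1 + s) *: v + p) - g (s *: v + p))) =
         (fun h => h^-1 *: (g (h *: v + (s *: v + p)) - g (s *: v + p))).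
  by apply/funext => h; rewrite [_%:A]mulr1 scalerDl addrA.
by move=> dg; split; rewrite /derivable /derive /= E.
Qed.

Lemma derive_shiftD g a p v : 'D_v (fun y => g (a + y)) p = 'D_v g (a + p).
Proof.
rewrite /derive; set F := (X in lim (X @ _) = _).
set G := (X in _ = lim (X @ _)).
suff -> : F = G by [].
by apply/funext => h; rewrite /F /G /= addrCA.
Qed.

Lemma derivable_shiftD g a p v :
  derivable g (a + p) v -> derivable (fun y => g (a + y)) p v.
Proof.
rewrite /derivable; set F := (X in cvg (X @ _) -> _).
set G := (X in _ -> cvg (X @ _)).
suff -> : F = G by [].
by apply/funext => h; rewrite /F /G /= addrCA.
Qed.

(** Directional derivability along the segment is all that the proof of
[second_difference] has at hand, for g in direction v and for 'D_v g in
direction w. *)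
Lemma MVT_line g p v h : 0 < h ->
  (forall s, 0 <= s <= h -> derivable g (s *: v + p) v) ->
  exists2 s, 0 <= s <= h & g (h *: v + p) - g p = h * 'D_v g (s *: v + p).
Proof.
move=> h0 dg.
have dl s : 0 <= s <= h ->
    is_derive s 1 (fun t => g (t *: v + p)) ('D_v g (s *: v + p)).
  by move=> sh; exact/is_derive_line/dg.
have dl' s : s \in `]0, h[%R ->
    is_derive s 1 (fun t => g (t *: v + p)) ('D_v g (s *: v + p)).
  by rewrite in_itv /= => /andP[s0 sh]; apply: dl; rewrite !ltW.
have cl : {within `[0, h], continuous (fun t => g (t *: v + p))}.
  apply: derivable_within_continuous => s; rewrite in_itv /= => sh.
  by have [] := dl s sh.
have [s] := MVT_segment (ltW h0) dl' cl.
by rewrite in_itv /= scale0r add0r subr0 mulrC => sh E; exists s.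
Qed.

(** The second difference over the parallelogram with sides h v and h w is the
increment along v of y |-> g (h w + y) - g y; the mean value theorem along v,
then along w, turns it into h^2 times a mixed derivative at a point of the
parallelogram. *)
Lemma second_difference g p v w h : 0 < h ->
  (forall s t, 0 <= s <= h -> 0 <= t <= h ->
    let y := s *: v + (t *: w + p) in
    derivable g y v /\ derivable ('D_v g) y w) ->
  exists s t, [/\ 0 <= s <= h, 0 <= t <= h &
    g (h *: w + (h *: v + p)) - g (h *: v + p) - (g (h *: w + p) - g p) =
    h * (h * 'D_w ('D_v g) (s *: v + (t *: w + p)))].
Proof.
move=> h0 dg.
have hh : 0 <= h <= h by rewrite lexx ltW.
have h00 : 0 <= (0 : R) <= h by rewrite lexx ltW.
pose D y := g (h *: w + y) - g y.
have dD s : 0 <= s <= h -> derivable (fun y => g (h *: w + y)) (s *: v + p) v /\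
    derivable g (s *: v + p) v.
  move=> sh; split.
    by apply: derivable_shiftD; rewrite addrCA; have [] := dg s h sh hh.
  by have [] := dg s 0 sh h00; rewrite scale0r add0r.
have [s sh Es] : exists2 s, 0 <= s <= h &
    D (h *: v + p) - D p = h * 'D_v D (s *: v + p).
  apply: MVT_line => // s sh; have [d1 d2] := dD s sh.
  exact: (derivableB d1 d2).
have [t th Et] : exists2 t, 0 <= t <= h &
    'D_v g (h *: w + (s *: v + p)) - 'D_v g (s *: v + p) =
    h * 'D_w ('D_v g) (t *: w + (s *: v + p)).
  by apply: MVT_line => // t th; rewrite addrCA; have [] := dg s t sh th.
exists s, t; split=> //; move: Es; rewrite /D => ->.
have [d1 d2] := dD s sh.
by rewrite (deriveB d1 d2) derive_shiftD Et addrCA.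
Qed.

(** The second difference is symmetric in v and w, so both mixed derivatives take
a common value at points of arbitrarily small parallelograms at a; conclude by
continuity at a. *)
Lemma clairaut g a v w :
  (\forall y \near a, [/\ derivable g y v, derivable g y w,
      derivable ('D_v g) y w & derivable ('D_w g) y v]) ->
  {for a, continuous ('D_w ('D_v g))} -> {for a, continuous ('D_v ('D_w g))} ->
  'D_w ('D_v g) a = 'D_v ('D_w g) a.
Proof.
move=> dg cvw cwv; apply/eqP; rewrite -subr_eq0 -normr_le0.
apply/ler_addgt0Pr => e e0; rewrite add0r.
have e20 : 0 < e / 2 by rewrite divr_gt0.
have tri (x y z : R) : `|x - z| < e / 2 -> `|y - z| < e / 2 -> `|x - y| <= e.
  move=> xz yz; rewrite -(subrKA z) (le_trans (ler_normD _ _))//.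
  by rewrite [e]splitr lerD ?ltW// distrC.
have /nbhs_ballP[d /= d0 ad] : \forall y \near a,
    [/\ derivable g y v, derivable g y w,
      derivable ('D_v g) y w & derivable ('D_w g) y v] /\
    `|'D_w ('D_v g) a - 'D_w ('D_v g) y| < e / 2 /\
    `|'D_v ('D_w g) a - 'D_v ('D_w g) y| < e / 2.
  move/cvgrPdist_lt: cvw => /(_ _ e20) nvw.
  move/cvgrPdist_lt: cwv => /(_ _ e20) nwv.
  exact: filterI dg (filterI nvw nwv).
(* h is small enough for the parallelogram with sides h v and h w at a to lie in
   the ball of radius d. *)
pose h := d / (2 * (`|v| + `|w| + 1)).
have N0 : 0 < `|v| + `|w| + 1 by rewrite ltr_wpDl// addr_ge0.
have h0 : 0 < h by rewrite divr_gt0// mulr_gt0.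
have hball s t : 0 <= s <= h -> 0 <= t <= h ->
    ball a d (s *: v + (t *: w + a)).
  move=> /andP[s0 sh] /andP[t0 th]; rewrite -ball_normE /=.
  rewrite addrA opprD addrCA subrr addr0 normrN.
  apply: (@le_lt_trans _ _ (h * (`|v| + `|w| + 1))).
    rewrite (le_trans (ler_normD _ _))// !normrZ !ger0_norm//.
    have sv : s * `|v| <= h * `|v| by rewrite ler_wpM2r.
    have tw : t * `|w| <= h * `|w| by rewrite ler_wpM2r.
    by rewrite !mulrDr mulr1 ler_wpDr ?lerD// ltW.
  by rewrite /h invfM mulrA -mulrA mulVf ?gt_eqF// mulr1 ltr_pdivrMr// ltr_pMr// ltr1n.
have [|s [t [sh th E1]]] := @second_difference g a v w h h0.
  by move=> s t sh th; have [[gv _ gvw _] _] := ad _ (hball s t sh th).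
have [|s' [t' [sh' th' E2]]] := @second_difference g a w v h h0.
  move=> s' t' sh' th'; rewrite addrCA.
  by have [[_ gw _ gwv] _] := ad _ (hball t' s' th' sh').
have E12 : g (h *: w + (h *: v + a)) - g (h *: v + a) - (g (h *: w + a) - g a) =
           g (h *: v + (h *: w + a)) - g (h *: w + a) - (g (h *: v + a) - g a).
  rewrite [h *: w + (h *: v + a)]addrCA.
  by rewrite -!addrA; congr (_ + _); rewrite !opprD !opprK addrCA.
have hI := mulfI (lt0r_neq0 h0).
have E := hI _ _ (hI _ _ (etrans (esym E1) (etrans E12 E2))).
rewrite [s' *: w + _]addrCA in E.
have [_ [A1 _]] := ad _ (hball s t sh th).
have [_ [_ A2]] := ad _ (hball t' s' th' sh').
by rewrite -E in A2; exact: tri A1 A2.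
Qed.

(** Derivatives of row-vector valued maps are computed entrywise. *)
Lemma clairaut_rV n (U : set V) (f : V -> 'rV[R]_n) a v w : open U -> U a ->
  Ck 2 U f -> 'D_w ('D_v f) a = 'D_v ('D_w f) a.
Proof.
move=> oU Ua [df f2].
have nU : \forall y \near a, U y by exact: open_nbhs_nbhs.
have d1 v' y : U y -> derivable f y v' by move=> /df/diff_derivable.
have d2 v' w' y : U y -> derivable ('D_v' f) y w'.
  by move=> Uy; apply: diff_derivable; have [+ _] := f2 v'; apply.
have c2 v' w' : {for a, continuous ('D_w' ('D_v' f))}.
  by have [_ /(_ w')] := f2 v'; apply.
have D1 i j v' y : U y -> 'D_v' f y i j = 'D_v' (fun z => f z i j) y.
  by move=> Uy; rewrite derive_mx ?mxE//; exact: d1.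
have N1 i j v' y : U y ->
    \forall z \near y, 'D_v' f z i j = 'D_v' (fun z => f z i j) z.
  move=> Uy; have : \forall y \near y, U y by exact: open_nbhs_nbhs.
  by apply: filterS => z; exact: D1.
have D2 i j v' w' y : U y ->
    'D_w' ('D_v' f) y i j = 'D_w' ('D_v' (fun z => f z i j)) y.
  move=> Uy; rewrite derive_mx ?mxE; last exact: d2.
  exact/near_eq_derive/N1.
have c2' i j v' w' : {for a, continuous ('D_w' ('D_v' (fun z => f z i j)))}.
  apply: (@near_eq_continuous _ _ (fun z => 'D_w' ('D_v' f) z i j)).
    by apply: filterS nU => z /D2.
  apply: (@continuous_comp _ _ _ _ (fun M : 'rV[R]_n => M i j)).
    exact: c2.
  exact: coord_continuous.
apply/matrixP => i j.
apply: (etrans (D2 i j v w a Ua) (etrans _ (esym (D2 i j w v a Ua)))).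
apply: clairaut; [|exact: c2'|exact: c2'].
apply: filterS nU => y Uy.
have C1 v' : derivable (fun z => f z i j) y v'.
  by move/derivable_mxP: (d1 v' y Uy).
have C2 v' w' : derivable ('D_v' (fun z => f z i j)) y w'.
  apply: (near_eq_derivable (N1 i j v' y Uy)).
  by move/derivable_mxP: (d2 v' w' y Uy).
by split; [exact: C1|exact: C1|exact: C2|exact: C2].
Qed.

End Clairaut.

(** * The Euclidean product and its derivative *)

Section Dot.
Variables (R : realType) (n : nat).
Implicit Types v w : 'rV[R]_n.

Lemma dotE v w : dot v w = \sum_j v 0 j * w 0 j.
Proof. by rewrite /dot mxE; apply: eq_bigr => j _; rewrite mxE. Qed.

Lemma dotC v w : dot v w = dot w v.
Proof. by rewrite !dotE; apply: eq_bigr => j _; rewrite mulrC. Qed.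

Lemma dotDl v1 v2 w : dot (v1 + v2) w = dot v1 w + dot v2 w.
Proof. by rewrite /dot mulmxDl mxE. Qed.

Lemma dotZl a v w : dot (a *: v) w = a * dot v w.
Proof. by rewrite /dot -scalemxAl mxE. Qed.

Lemma dotDr v w1 w2 : dot v (w1 + w2) = dot v w1 + dot v w2.
Proof. by rewrite dotC dotDl !(dotC _ v). Qed.

Lemma dotZr a v w : dot v (a *: w) = a * dot v w.
Proof. by rewrite dotC dotZl (dotC w). Qed.

Lemma dot_eq0 v : dot v v = 0 -> v = 0.
Proof.
rewrite dotE => /eqP; rewrite psumr_eq0; last by move=> j _; rewrite -expr2 sqr_ge0.
move=> /allP v0; apply/rowP => j; rewrite mxE.
by apply/eqP; have := v0 j (mem_index_enum j); rewrite /= mulf_eq0 orbb.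
Qed.

Lemma is_derive_dot (V : normedModType R) (f g : V -> 'rV[R]_n) (u v : V) :
  derivable f u v -> derivable g u v ->
  is_derive u v (fun y => dot (f y) (g y))
    (dot ('D_v f u) (g u) + dot (f u) ('D_v g u)).
Proof.
move=> df dg.
have dfj j : derivable (fun y => f y 0 j) u v by move/derivable_mxP: df.
have dgj j : derivable (fun y => g y 0 j) u v by move/derivable_mxP: dg.
have -> : (fun y => dot (f y) (g y)) =
    \sum_j ((fun y => f y 0 j) * (fun y => g y 0 j)).
  by apply/funext => y; rewrite dotE fct_sumE.
apply: (@is_derive_eq _ _ _ _ _ _ _ (\sum_j (f u 0 j *: 'D_v (fun y => g y 0 j) u
    + g u 0 j *: 'D_v (fun y => f y 0 j) u))).
  apply: is_derive_sum => j.
  by apply: is_deriveM; apply: derivableP.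
rewrite !derive_mx// !dotE -big_split; apply: eq_bigr => j _ /=.
by rewrite !mxE addrC /GRing.scale /= [g u 0 j * _]mulrC.
Qed.

End Dot.

(** * Tangent and normal parts, symmetry of the second fundamental form *)

Section TangentNormal.
Variable R : realType.
Implicit Types (f n : 'rV[R]_2 -> 'rV[R]_4) (u : 'rV[R]_2) (w : 'rV[R]_4).

Lemma normal_kermx f u w : normal f u w -> (w <= kermx ('J f u)^T)%MS.
Proof.
move=> nw; apply/sub_kermxP/trmx_inj; rewrite trmx_mul trmxK trmx0.
apply/row_matrixP => i; rewrite row_mul row0.
apply/matrixP => j k; rewrite !ord1 [RHS]mxE.
exact: (nw _ (row_sub i _)).
Qed.

(** The Euclidean product is positive definite, so a vector orthogonal to itself
vanishes; this is what makes [tan_proj] a projection. *)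
Lemma tan_nor_direct f u : (<<'J f u>> :&: kermx ('J f u)^T = 0)%MS.
Proof.
apply/row_matrixP => i; rewrite row0; set w := row i _.
have : (w <= <<'J f u>> :&: kermx ('J f u)^T)%MS by exact: row_sub.
rewrite sub_capmx genmxE => /andP[/submxP[a wE] /sub_kermxP w0].
by apply: dot_eq0; rewrite /dot {2}wE trmx_mul mulmxA w0 mul0mx mxE.
Qed.

Lemma tan_proj_tangent f u w : tangent f u w -> w *m tan_proj f u = w.
Proof.
by move=> tw; apply: proj_mx_id; [exact: tan_nor_direct|rewrite genmxE].
Qed.

Lemma tan_proj_normal f u w : normal f u w -> w *m tan_proj f u = 0.
Proof.
by move=> /normal_kermx nw; apply: proj_mx_0 => //; exact: tan_nor_direct.
Qed.

Lemma derive_tangent f u v : differentiable f u -> tangent f u ('D_v f u).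
Proof. by move=> df; rewrite deriveEjacobian//; exact: submxMl. Qed.

Lemma flat_derivE f n u v : row_free ('J f u) -> differentiable f u ->
  differentiable n u -> 'D_v f u *m flat_deriv f n u = 'D_v n u.
Proof.
move=> fr df dn; rewrite !deriveEjacobian// /flat_deriv mulmxA; congr (_ *m _).
by apply: (row_free_inj fr); rewrite mulmxKpV ?submxMl.
Qed.

(** The normal connection is the normal part of the flat derivative: a field is
parallel when its flat derivatives have none. *)
Lemma parallel_derive_tangent f n u v : row_free ('J f u) ->
  differentiable f u -> differentiable n u -> parallel_at f n u ->
  tangent f u ('D_v n u).
Proof.
move=> fr df dn /(_ _ (derive_tangent v df)).
rewrite /normal_conn mulmxA flat_derivE// mulmxBr mulmx1 => /eqP.
rewrite subr_eq0 => /eqP ->.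
by apply: (submx_trans (proj_mx_sub _ _ _)); rewrite genmxE.
Qed.

(** Differentiating <df(v), n> = 0 along v' gives
<df(v), dn(v')> = - <d^2f(v, v'), n>, and d^2f is symmetric. *)
Lemma derive_normal_sym f n (U : set 'rV[R]_2) u v v' : open U -> U u ->
  Ck 2 U f -> differentiable n u -> (\forall y \near u, normal f y (n y)) ->
  dot ('D_v f u) ('D_v' n u) = dot ('D_v' f u) ('D_v n u).
Proof.
move=> oU Uu f3 dn nn.
have [df f2] := f3.
have nU : \forall y \near u, U y by exact: open_nbhs_nbhs.
have H s t : dot ('D_t ('D_s f) u) (n u) + dot ('D_s f u) ('D_t n u) = 0.
  have dsf : derivable ('D_s f) u t.
    by apply: diff_derivable; have [+ _] := f2 s; apply.
  have [_ <-] := is_derive_dot dsf (diff_derivable dn).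
  rewrite -(derive_cst (0 : R) u t); apply: near_eq_derive.
  apply: filterS2 nU nn => y Uy; apply.
  exact/derive_tangent/df.
apply: (addrI (dot ('D_v' ('D_v f) u) (n u))).
by rewrite H (@clairaut_rV _ _ _ U f u v v' oU Uu f3) H.
Qed.

End TangentNormal.

(** * Normal fields along a constant slope surface *)

Section ConstantSlope.
Variable R : realType.
Implicit Types (f e n : 'rV[R]_2 -> 'rV[R]_4) (u v : 'rV[R]_2).

(** Here k and l stand for the cosine and sine of the slope angle.  The function
s = <f, e3> = mu l is used in place of mu because it is differentiable as a
product of differentiable fields, and the relations s^2 = l^2 <f, f> and
<f, n> = s <e3, n> are differentiated. *)
Lemma constant_slope_derive f e1 e3 n (mu : 'rV[R]_2 -> R) (k l : R) u v :
  l != 0 -> 0 < mu u ->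
  (\forall y \near u,
    [/\ mu y ^+ 2 = dot (f y) (f y), dot (e3 y) (e3 y) = 1,
        tangent f y (e1 y), normal f y (e3 y) & normal f y (n y)]) ->
  (\forall y \near u, f y = (mu y * k) *: e1 y + (mu y * l) *: e3 y) ->
  differentiable f u -> differentiable e3 u -> differentiable n u ->
  tangent f u ('D_v e3 u) ->
  dot ((mu u * k) *: e1 u) ('D_v n u) =
    l * k * dot (e1 u) ('D_v f u) * dot (n u) (e3 u).
Proof.
move=> l0 mu0 nH nf df de3 dn te3.
have [dfv de3v dnv] : [/\ derivable f u v, derivable e3 u v & derivable n u v].
  by split; exact: diff_derivable.
pose s y := dot (f y) (e3 y).
have sE : \forall y \near u, s y = mu y * l.
  apply: filterS2 nH nf => y [_ e33 te1 ne3 _] fE.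
  by rewrite /s {1}fE dotDl !dotZl (ne3 _ te1) e33; ring.
have ds : is_derive u v s ('D_v s u).
  by have [ds _] := is_derive_dot dfv de3v; exact: derivableP.
have Ds : 'D_v s u = l * k * dot (e1 u) ('D_v f u).
  have sf : \forall y \near u, s y * s y = l ^+ 2 * dot (f y) (f y).
    by apply: filterS2 nH sE => y [<- _ _ _ _] ->; ring.
  have [_ D1] := is_deriveM ds ds.
  have [df2 D2] := is_derive_dot dfv dfv.
  have /= := near_eq_derive v sf.
  rewrite (deriveMl (l ^+ 2) df2) D2.
  have -> : 'D_v (fun y => s y * s y) u = s u *: 'D_v s u + s u *: 'D_v s u.
    by rewrite -D1.
  rewrite (nbhs_singleton sE) (dotC _ (f u)) (nbhs_singleton nf) dotDl !dotZl.
  have [_ _ _ ne3 _] := nbhs_singleton nH.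
  rewrite [dot (e3 u) _]dotC (ne3 _ (derive_tangent v df)) /GRing.scale /= => E.
  have m0 : 2 * (mu u * l) != 0 by rewrite !mulf_neq0 ?pnatr_eq0 ?(lt0r_neq0 mu0).
  apply: (mulfI m0); transitivity (mu u * l * 'D_v s u + mu u * l * 'D_v s u).
    by ring.
  by rewrite E; ring.
have nx : \forall y \near u, dot (f y) (n y) = s y * dot (e3 y) (n y).
  apply: filterS3 nH nf sE => y [_ _ te1 _ nn] fE ->.
  by rewrite {1}fE dotDl !dotZl (nn _ te1); ring.
have [_ D1] := is_derive_dot dfv dnv.
have de3n := is_derive_dot de3v dnv.
have [_ D2] := is_deriveM ds de3n.
have := near_eq_derive v nx.
have -> : 'D_v (fun y => s y * dot (e3 y) (n y)) u =
  s u *: (dot ('D_v e3 u) (n u) + dot (e3 u) ('D_v n u))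
    + dot (e3 u) (n u) *: 'D_v s u by rewrite -D2.
have [_ _ _ _ nn] := nbhs_singleton nH.
rewrite D1 (nn _ te3) (nn _ (derive_tangent v df)) {1}(nbhs_singleton nf).
rewrite Ds (nbhs_singleton sE) dotDl !dotZl (dotC (n u)) /GRing.scale /=.
rewrite !add0r [_ + mu u * l * _]addrC => /addrI ->.
by ring.
Qed.

End ConstantSlope.

(* xi ranges over all normal vector fields defined on open subsets of M, hence
   xi p over all normal vectors at all points p = r u of M. *)
Theorem corollary3p4 (R : realType) (M : topologicalType) (x : M -> 'rV[R]_4)
    (theta : R) (theta_gt0 : 0 < theta) (theta_lt : theta < pi / 2%:R)
    (css : constant_slope_surface x theta) :
  forall (V : set M) (xi : M -> 'rV[R]_4), open V -> normal_field x V xi ->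
  forall (U : set 'rV[R]_2) (r : 'rV[R]_2 -> M), local_param x U r ->
  forall u : 'rV[R]_2, U u -> V (r u) ->
    principal_direction (x \o r) (xi \o r) u (tan_part (x \o r) u (x (r u))).
Proof.
move=> V xi oV [sxi nxi] U r Ur u Uu Vu.
have [_ [mu [e1 [e3 [mux [[_ te1] ue1] [[se3 ne3] ue3 pe3] xE]]]]] := css.
have [oU [rc _] _ sf fr] := Ur.
set f := x \o r; set n := xi \o r.
have sin0 : 0 < sin theta.
  apply: sin_gt0_pi; rewrite theta_gt0 (lt_trans theta_lt)//.
  by rewrite ltr_pdivrMr// ltr_pMr ?pi_gt0// ltr1n.
have cos0 : 0 < cos theta.
  apply: cos_gt0_pihalf; rewrite theta_lt andbT (lt_trans _ theta_gt0)//.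
  by rewrite oppr_lt0 divr_gt0 ?pi_gt0.
have nU : \forall y \near u, U y by exact: open_nbhs_nbhs.
have nV : \forall y \near u, V (r y).
  by apply: (rc u Uu); exact: open_nbhs_nbhs.
have [df _] := sf 1%N.
have [dn _] := sxi U r Ur 1%N.
have [de3 _] := se3 U r Ur 1%N.
have {}df := df u Uu; have {}dn := dn u (conj Uu Vu).
have {}de3 := de3 u (conj Uu I).
have nn : \forall y \near u, normal f y (n y).
  by apply: filterS2 nU nV => y Uy Vy; exact: (nxi U r Ur y Uy Vy).
have Te1 := te1 U r Ur u Uu I.
have mu0 : 0 < mu (r u) by have [] := mux (r u).
pose T := (mu (r u) * cos theta) *: e1 (r u).
have TE : tan_part f u (x (r u)) = T.
  rewrite /tan_part xE mulmxDl -!scalemxAl tan_proj_tangent//.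
  by rewrite tan_proj_normal ?scaler0 ?addr0//; exact: (ne3 U r Ur u Uu I).
have tT : tangent f u T by exact: scalemx_sub.
have /submxP[t tE] := tT.
have TD : 'D_t f u = T by rewrite deriveEjacobian.
pose c := sin theta * cos theta * dot (n u) (e3 (r u)).
(* t represents T in the parameters, so this is the tangential part of dn(T); it
   is c e1 because the difference dn(T) - c e1 is orthogonal to every df(v). *)
have key : 'D_t n u *m tan_proj f u = c *: e1 (r u).
  have dotB w : dot w ('D_t n u - c *: e1 (r u)) =
      dot w ('D_t n u) - c * dot w (e1 (r u)).
    by rewrite -scaleN1r scalerA dotDr dotZr mulN1r mulNr.
  have nrm : normal f u ('D_t n u - c *: e1 (r u)).
    move=> _ /submxP[v ->]; rewrite -deriveEjacobian// dotB.
    rewrite (@derive_normal_sym _ f n U u v t oU Uu (sf 2%N) dn nn) TD.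
    rewrite (@constant_slope_derive _ f (e1 \o r) (e3 \o r) n (mu \o r)
      (cos theta) (sin theta) u v)//.
    - by rewrite /c (dotC _ (e1 (r u))) /=; ring.
    - exact: lt0r_neq0.
    - apply: filterS2 nU nn => y Uy ny.
      have [_ muy] := mux (r y).
      by split; [exact: muy|exact: ue3|exact: (te1 U r Ur y Uy I)
                |exact: (ne3 U r Ur y Uy I)|exact: ny].
    - by apply: filterS nU => y _; exact: xE.
    - apply: parallel_derive_tangent => //; first exact: fr.
      exact: (pe3 U r Ur u Uu I).
  have := tan_proj_normal nrm; rewrite mulmxBl -scalemxAl.
  by rewrite (tan_proj_tangent Te1) => /eqP; rewrite subr_eq0 => /eqP.
rewrite TE; split=> //.
- rewrite scaler_eq0 negb_or mulf_neq0 ?lt0r_neq0//=.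
  apply/eqP => e10; have := ue1 (r u); rewrite e10 /dot mul0mx mxE => /eqP.
  by rewrite eq_sym oner_eq0.
- exists (- (c / (mu (r u) * cos theta))); apply/eigenspaceP.
  rewrite /shape_op mulmxN mulmxA -{1}TD flat_derivE ?fr// key.
  by rewrite scaleNr /T scalerA divfK// mulf_neq0 ?lt0r_neq0.
Qed.
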